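(* Let $\mathcal{I}$ be an ideal on $\omega$. Then the following are equivalent: (i) $\mathcal{I}$ is a $P$-ideal; (ii) $\mathsf{H}_{\boldsymbol{a}}(\mathcal{I})=\mathsf{H}^\star_{\boldsymbol{a}}(\mathcal{I})$ for all sequences $\boldsymbol{a}\in\mathbb{Z}^\omega$; (iii) $\mathsf{H}_{\boldsymbol{a}}(\mathcal{I})=\mathsf{H}^\star_{\boldsymbol{a}}(\mathcal{I})$ for some sequence $\boldsymbol{a}=(a_n:n\in\omega)\in(\omega\setminus\{0\})^\omega$ such that $\lim_{n} a_n/a_{n+1}=0$.
   Context: $\omega=\{0,1,2,\dots\}$; $\mathbb{T}=\mathbb{R}/\mathbb{Z}$; reals are identified with their classes mod $\mathbb{Z}$, and $\|x\|:=\min\{|x-z|:z\in\mathbb{Z}\}$. An ideal on $\omega$ is a family $\mathcal{I}\subseteq\mathcal{P}(\omega)$ closed under subsets and finite unions, containing all finite subsets of $\omega$, and with $\omega\notin\mathcal{I}$. $\mathcal{I}$ is a $P$-ideal if for every sequence $(S_n:n\in\omega)$ of sets in $\mathcal{I}$ there is $S\in\mathcal{I}$ such that $S_n\setminus S$ is finite for all $n$. A sequence $(x_n)$ in $\mathbb{T}$ is $\mathcal{I}$-convergent to $\eta$ if $\{n\in\omega:\|x_n-\eta\|\ge\varepsilon\}\in\mathcal{I}$ for all $\varepsilon>0$; it is $\mathcal{I}^\star$-convergent to $\eta$ if there is $S\in\mathcal{I}$ such that $(x_n:n\in\omega\setminus S)$ converges to $\eta$ in the ordinary sense. For $\boldsymbol{a}=(a_n:n\in\omega)\in\mathbb{Z}^\omega$,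 $\mathsf{H}_{\boldsymbol{a}}(\mathcal{I}):=\{x\in\mathbb{T}:\mathcal{I}\text{-}\lim_n a_nx=0\}$ and $\mathsf{H}^\star_{\boldsymbol{a}}(\mathcal{I}):=\{x\in\mathbb{T}:\mathcal{I}^\star\text{-}\lim_n a_nx=0\}$. *)

(* Defs.v *)
From HB Require Import structures.
From mathcomp Require Import all_boot all_order all_algebra.
From mathcomp Require Import all_classical all_reals all_analysis.
From mathcomp Require Import ring.

Set Implicit Arguments.
Unset Strict Implicit.
Unset Printing Implicit Defensive.

Import Order.TTheory GRing.Theory Num.Theory.
Import numFieldNormedType.Exports.

Local Open Scope classical_set_scope.
Local Open Scope ring_scope.
Local Open Scope quotient_scope.

Definition omega_ideal (I : set (set nat)) : Prop :=
  [/\ forall A B, A `<=` B -> I B -> I A,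
      forall A B, I A -> I B -> I (A `|` B),
      forall A, finite_set A -> I A
    & ~ I setT].

Definition P_ideal (I : set (set nat)) : Prop :=
  omega_ideal I /\
  forall S : nat -> set nat, (forall n, I (S n)) ->
    exists2 T, I T & forall n, finite_set (S n `\` T).

(* The predicate underlying the qualifier [Num.int]. *)
Definition integers (R : realType) : zmodClosed R :=
  GRing.ZmodClosed.clone R (@Num.int_num_subdef R) _.

(* For t : torus R and m : int, the multiple m t is [t *~ m]. *)
Definition torus (R : realType) : Type := Quotient.quot (integers R).

HB.instance Definition _ (R : realType) := GRing.Zmodule.on (torus R).
HB.instance Definition _ (R : realType) :=
  EqQuotient.copy (torus R) (Quotient.quot (integers R)).

Definition distZ (R : realType) (x : R) : R :=
  inf [set `|x - z%:~R| | z in [set: int]].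

(* [distZ_min] and [tnorm_pi] below: the infimum is a minimum, and [tnorm] does
   not depend on the representative. *)
Definition tnorm (R : realType) (t : torus R) : R :=
  distZ (repr t).

Definition ideal_cvg (R : realType) (I : set (set nat))
    (x : nat -> torus R) (eta : torus R) : Prop :=
  forall e : R, 0 < e -> I [set n | e <= tnorm (x n - eta)].

(* Convergence along [within (~` S) \oo] is ordinary convergence of the
   restriction of the sequence to the complement of S. *)
Definition ideal_star_cvg (R : realType) (I : set (set nat))
    (x : nat -> torus R) (eta : torus R) : Prop :=
  exists2 S, I S &
    tnorm (x n - eta) @[n --> within (~` S) \oo] --> (0 : R).

Definition Hset (R : realType) (a : nat -> int) (I : set (set nat)) :
    set (torus R) :=
  [set x | ideal_cvg I (fun n => x *~ a n) 0].

Definition Hset_star (R : realType) (a : nat -> int) (I : set (set nat)) :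
    set (torus R) :=
  [set x | ideal_star_cvg I (fun n => x *~ a n) 0].

Arguments Hset R a I : clear implicits.
Arguments Hset_star R a I : clear implicits.

Lemma distZ_le (R : realType) (x : R) (z : int) : distZ x <= `|x - z%:~R|.
Proof.
apply: ge_inf; last by exists z.
by exists 0 => _ [y _ <-].
Qed.

Lemma distZ_min (R : realType) (x : R) :
  exists z : int, distZ x = `|x - z%:~R|.
Proof.
suff [z zmin] : exists z : int, forall y : int, `|x - z%:~R| <= `|x - y%:~R|.
  exists z; apply/eqP; rewrite eq_le distZ_le /=.
  apply: lb_le_inf; first by exists `|x - z%:~R|, z.
  by move=> _ [y _ <-].
have fx : (Num.floor x)%:~R <= x by exact: Num.Theory.floor_le.
have xf : x < (Num.floor x + 1)%:~R by exact: floorD1_gt.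
set f := Num.floor x in fx xf *.
have lo (y : int) : y <= f -> x - f%:~R <= `|x - y%:~R|.
  by move=> yf; rewrite (le_trans _ (ler_norm _))// lerB// ler_int.
have hi (y : int) : f < y -> (f + 1)%:~R - x <= `|x - y%:~R|.
  move=> fy; rewrite distrC (le_trans _ (ler_norm _))// lerB// ler_int.
  by rewrite addrC lez1D.
have absf : `|x - f%:~R| = x - f%:~R by rewrite ger0_norm// subr_ge0.
have absf1 : `|x - (f + 1)%:~R| = (f + 1)%:~R - x.
  by rewrite distrC gtr0_norm// subr_gt0.
have [le|/ltW le] := leP (x - f%:~R) ((f + 1)%:~R - x).
  exists f => y; rewrite absf; case: (leP y f) => [/lo//|/hi].
  exact: le_trans.
exists (f + 1) => y; rewrite absf1; case: (leP y f) => [/lo|/hi//].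
exact: le_trans.
Qed.

Lemma distZ_int (R : realType) (x y : R) :
  x - y \is a Num.int -> distZ x = distZ y.
Proof.
suff le u v : u - v \is a Num.int -> distZ u <= distZ v :> R.
  by move=> xy; apply/eqP; rewrite eq_le !le// -opprB rpredN.
move=> /intrP[m uv]; have [z ->] := distZ_min v.
have -> : v - z%:~R = u - (z + m)%:~R.
  by rewrite intrD -uv; ring.
exact: distZ_le.
Qed.

Lemma tnorm_pi (R : realType) (x : R) : tnorm (\pi_(torus R) x) = distZ x.
Proof.
apply: distZ_int.
have : repr (\pi_(torus R) x) == x %[mod torus R] by rewrite reprK.
by rewrite -Quotient.idealrBE.
Qed.

Lemma pi_torusMz (R : realType) (x : R) (m : int) :
  \pi_(torus R) (x *~ m) = \pi_(torus R) x *~ m.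
Proof.
exact: (raddfMz (\pi_(Quotient.quot (integers R)) : {additive R -> _})).
Qed.

(* Main.v *)
Require Import Defs.
From mathcomp Require Import all_boot all_order all_algebra.
From mathcomp Require Import all_classical all_reals all_analysis.
From mathcomp Require Import ring lra.
Import Order.TTheory GRing.Theory Num.Theory.
Import numFieldNormedType.Exports.
Local Open Scope classical_set_scope.
Local Open Scope ring_scope.

(** Membership of [t] in the two subgroups only concerns the real sequence
    [u n = tnorm (t *~ a n)] >= 0: it says that [u] tends to 0 along the ideal
    ([ideal_null]), respectively tends to 0 off a set of the ideal
    ([ideal_star_null]).  The second always implies the first, because a set
    of the form [e <= u n] is then covered by a set of [I] and a finite set.
    The theorem comes down to comparing the two notions for enough sequences.

    For a P-ideal they agree on every nonnegative sequence
    ([P_ideal_null_star]): a pseudo-union of the sets [1 / (k + 1) <= u n] is a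
    set off which [u] converges.  Conversely, agreement on the sequences with
    values in [0, 1/2] already forces the P-property
    ([P_ideal_of_null_star]): given sets [S k] in [I], let [f n] be 1 / (k + 2)
    for the first [k] such that [n] is in [S k], the search being cut off as in
    [level]; a set off which [f] tends to 0 must contain almost all of each
    [S k].

    So it remains to see each such [f], up to a null sequence, as the sequence
    of norms of the multiples [a n * x] of a single [x].  When
    [a n / a n.+1] tends to 0 this is possible ([lacunary_approx]): each
    condition that [a n * x] be close to [f n] modulo 1 is a condition on the
    next digit of [x] in the scale [1 / a n], and the digits that come later
    move [a n * x] only by [O (a n / a n.+1)].  Both notions of convergence are
    insensitive to null perturbations, so [f] inherits their agreement from
    [x], and hence [I] is a P-ideal.

    A sequence to start from is [a n = n!], whose ratios are 1 / (n + 1). *)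

Definition ideal_null (R : realType) (I : set (set nat)) (u : nat -> R) :=
  forall e : R, 0 < e -> I [set n | e <= u n].

Definition ideal_star_null (R : realType) (I : set (set nat)) (u : nat -> R) :=
  exists2 S, I S & u n @[n --> within (~` S) \oo] --> (0 : R).

Arguments ideal_null {R} I u.
Arguments ideal_star_null {R} I u.

Lemma finite_set_near (A : set nat) :
  finite_set A <-> \forall n \near \oo, ~ A n.
Proof.
split=> [/finite_fsetP[X AX]|[N _ HN]].
  exists (\max_(i <- finmap.enum_fset X) i).+1 => // n /= Xn; rewrite AX /= => nX.
  by move: Xn; rewrite ltnNge (@leq_bigmax_seq _ _ xpredT id).
apply: sub_finite_set (finite_II N) => n An /=.
by rewrite ltnNge; apply/negP => /HN.
Qed.

(** The P-property speaks of finite differences of sets; this is the form of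
    convergence off [S] that it produces and consumes. *)
Lemma within_cvg0P {R : realType} (S : set nat) (u : nat -> R) :
  (forall n, 0 <= u n) ->
  (u n @[n --> within (~` S) \oo] --> (0 : R)) <->
  (forall e : R, 0 < e -> finite_set ([set n | e <= u n] `\` S)).
Proof.
move=> u0; split=> [/cvgrPdist_lt uS e e0|uS].
  apply/finite_set_near; have := uS e e0.
  rewrite near_withinE; apply: filterS => n uSn [/= eun /uSn].
  by rewrite sub0r normrN ger0_norm// ltNge eun.
apply/cvgrPdist_lt => e e0; rewrite near_withinE.
have /finite_set_near := uS e e0; apply: filterS => n uSn Sn.
by rewrite sub0r normrN ger0_norm// ltNge; apply/negP => ?; apply: uSn.
Qed.

Lemma ideal_star_null_null {R : realType} (I : set (set nat)) (u : nat -> R) :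
  omega_ideal I -> (forall n, 0 <= u n) ->
  ideal_star_null I u -> ideal_null I u.
Proof.
move=> [Isub IU Ifin _] u0 [S IS /(within_cvg0P _ _ u0) uS] e e0.
apply: Isub (IU _ _ (Ifin _ (uS e e0)) IS) => n eun.
by have [Sn|Sn] := pselect (S n); [right|left].
Qed.

(** A single set almost containing every [1 / (k + 1) <= u n] works, since these
    countably many level sets are cofinal among all the sets [e <= u n]. *)
Lemma P_ideal_null_star {R : realType} (I : set (set nat)) (u : nat -> R) :
  P_ideal I -> (forall n, 0 <= u n) ->
  ideal_null I u -> ideal_star_null I u.
Proof.
move=> [_ IP] u0 Iu.
have [|T IT HT] := IP (fun k => [set n | k.+1%:R^-1 <= u n]).
  by move=> k; apply: Iu.
exists T => //; apply/within_cvg0P => // e e0.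
have [k _ /(_ k (leqnn k)) /= ke] := near_infty_natSinv_lt (PosNum e0).
apply: sub_finite_set (HT k) => n [/= eun nT]; split=> //=.
exact: le_trans (ltW ke) eun.
Qed.

Lemma ideal_bigcup_lt (I : set (set nat)) (S : nat -> set nat) (K : nat) :
  omega_ideal I -> (forall k, I (S k)) ->
  I [set n | exists2 k, (k < K)%N & S k n].
Proof.
move=> [Isub IU Ifin _] IS; elim: K => [|K IHK].
  by apply: Ifin; apply: sub_finite_set (finite_set0 _) => n [].
apply: Isub (IU _ _ IHK (IS K)) => n [k]; rewrite ltnS leq_eqVlt.
by case/orP => [/eqP ->|kK] Skn; [right|left; exists k].
Qed.

(** The search for the first [k] with [n] in [S k] is cut off at [k < n] and
    returns [n] when it fails.  This keeps the value defined for points that lie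
    in no [S k], makes it tend to infinity along them, and alters the level of
    only finitely many points of each [S k]. *)
Definition level (S : nat -> set nat) (n : nat) : nat :=
  find (fun k => `[< S k n >]) (iota 0 n).

Lemma level_le (S : nat -> set nat) (k n : nat) :
  (k < n)%N -> S k n -> (level S n <= k)%N.
Proof.
move=> kn Skn; rewrite leqNgt; apply/negP => /(before_find 0%N).
by rewrite nth_iota// add0n => /asboolP.
Qed.

Lemma levelP (S : nat -> set nat) (n : nat) :
  level S n = n \/ S (level S n) n.
Proof.
have := find_size (fun k => `[< S k n >]) (iota 0 n).
rewrite size_iota leq_eqVlt => /orP[/eqP|ln]; first by left.
right; have : has (fun k => `[< S k n >]) (iota 0 n).
  by rewrite has_find size_iota.
by move=> /(nth_find 0%N); rewrite nth_iota// add0n => /asboolP.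
Qed.

(** The reciprocal of the level is null along [I], because the points of level
    below [K] lie in [S 0], ..., [S K.-1] or below [K]; it is bounded below on
    almost all of each [S k], so it can tend to 0 only off a set that almost
    contains [S k]. *)
Lemma P_ideal_of_null_star {R : realType} (I : set (set nat)) :
  omega_ideal I ->
  (forall f : nat -> R, (forall n, 0 <= f n <= 2^-1) ->
    ideal_null I f -> ideal_star_null I f) ->
  P_ideal I.
Proof.
move=> hI H; split=> // S IS; have [Isub IU Ifin _] := hI.
(* The shift by 2 keeps the values within [0, 1/2], where [distZ] is the
   identity. *)
pose f n : R := (level S n).+2%:R^-1.
have f0 n : 0 <= f n by rewrite invr_ge0.
have [|e e0|T IT /(within_cvg0P _ _ f0) fT] := H f.
- by move=> n; rewrite f0 /= lef_pV2 ?posrE// ler_nat.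
- have [K _ /(_ K (leqnn K)) /= Ke] := near_infty_natSinv_lt (PosNum e0).
  apply: Isub (IU _ _ (ideal_bigcup_lt I S K hI IS) (Ifin _ (finite_II K))).
  move=> n /= efn.
  have lK : (level S n < K)%N.
    have := lt_le_trans Ke efn.
    by rewrite ltf_pV2 ?posrE// ltr_nat !ltnS; apply: leq_trans.
  by have [<-|?] := levelP S n; [right|left; exists (level S n)].
exists T => // k; apply/finite_set_near.
have /finite_set_near fTk := fT k.+2%:R^-1 ltac:(by rewrite invr_gt0).
near=> n => -[Skn nT].
have : ~ ([set n | k.+2%:R^-1 <= f n] `\` T) n by near: n.
apply; split=> //=; rewrite lef_pV2 ?posrE// ler_nat !ltnS level_le//.
by near: n; exists k.+1.
Unshelve. all: by end_near. Qed.

Lemma distZ_ge0 (R : realType) (x : R) : 0 <= distZ x.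
Proof. by have [z ->] := distZ_min x. Qed.

Lemma distZ_half (R : realType) (x : R) : 0 <= x <= 2^-1 -> distZ x = x.
Proof.
move=> /andP[x0 x1]; apply/le_anti/andP; split.
  by rewrite (le_trans (distZ_le x 0))// subr0 ger0_norm.
have [z ->] := distZ_min x; have [z0|z1] := leP z 0.
  by rewrite (le_trans _ (ler_norm _))// lerBrDr gerDl lerz0.
rewrite distrC (le_trans _ (ler_norm _))//.
have : (1 : R) <= z%:~R by rewrite ler1z.
lra.
Qed.

Lemma distZ_dist (R : realType) (x y : R) :
  `|distZ x - distZ y| <= distZ (x - y).
Proof.
have le (u v : R) : distZ u - distZ v <= distZ (u - v).
  have [m vm] := distZ_min v; have [k ->] := distZ_min (u - v).
  rewrite lerBlDr vm (le_trans (distZ_le u (k + m)))// intrD.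
  by rewrite (le_trans _ (ler_normD _ _))//; have -> : u - (k%:~R + m%:~R) =
    u - v - k%:~R + (v - m%:~R) by ring.
have distZC (u : R) : distZ (- u) = distZ u.
  have opp (w : R) : distZ (- w) <= distZ w.
    have [m ->] := distZ_min w; rewrite (le_trans (distZ_le _ (- m)))//.
    by rewrite intrN -opprD normrN.
  by apply/le_anti; rewrite opp -{1}(opprK u) opp.
by rewrite ler_norml le andbT lerNl opprB -(distZC (x - y)) opprB le.
Qed.

(** For positive [a m], the next term is the least real [y >= approx a f m] such
    that [a m * y] is congruent to [f m] modulo 1.  Always moving upwards makes
    the sequence monotone, so that its limit is a supremum. *)
Fixpoint approx {R : realType} (a f : nat -> R) (n : nat) : R :=
  if n is m.+1 then
    ((Num.ceil (a m * approx a f m - f m))%:~R + f m) / a m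
  else 0.

Lemma approx_hit {R : realType} (a f : nat -> R) (n : nat) : 0 < a n ->
  a n * approx a f n.+1 - f n = (Num.ceil (a n * approx a f n - f n))%:~R.
Proof. by move=> a0 /=; field; rewrite gt_eqF. Qed.

Lemma approx_step {R : realType} (a f : nat -> R) (n : nat) : 0 < a n ->
  approx a f n <= approx a f n.+1 <= approx a f n + (a n)^-1.
Proof.
move=> a0; have /andP[] := ceil_itv (a n * approx a f n - f n).
rewrite intrB -approx_hit// => lo hi.
apply/andP; split; rewrite -(ler_pM2l a0) ?mulrDr ?divff ?gt_eqF//; lra.
Qed.

(** With [y = approx a f], once [a n.+1 >= 2 * a n] the terms [y n] increase while
    [y n + 2 / a n] decreases, so their common limit [x] satisfies
    [y n.+1 <= x <= y n.+1 + 2 / a n.+1].  As [a n * y n.+1] is exactly [f n]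
    modulo 1, the error of [a n * x] is at most [2 * (a n / a n.+1)]. *)
Lemma lacunary_approx {R : realType} (a f : nat -> R) :
  (forall n, 0 < a n) -> (a n / a n.+1) @[n --> \oo] --> (0 : R) ->
  exists x : R, distZ (a n * x - f n) @[n --> \oo] --> (0 : R).
Proof.
move=> a0 a_lac; pose y := approx a f.
have y_step n : y n <= y n.+1 <= y n + (a n)^-1 by exact: approx_step.
have y_mono m n : (m <= n)%N -> y m <= y n.
  elim: n => [|n IHn]; first by rewrite leqn0 => /eqP ->.
  rewrite leq_eqVlt => /orP[/eqP->//|/IHn /le_trans]; apply.
  by have /andP[] := y_step n.
have [N _ HN] : \forall n \near \oo, 2 * (a n.+1)^-1 <= (a n)^-1.
  have /cvgrPdist_lt/(_ 2^-1) := a_lac.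
  move=> /(_ ltac:(by rewrite invr_gt0)); apply: filterS => n.
  rewrite sub0r normrN gtr0_norm ?divr_gt0// => lt2.
  by rewrite -(ler_pM2l (a0 n)) divff ?gt_eqF//; lra.
have y_le m n : (N <= n)%N -> (n <= m)%N ->
    y m + 2 * (a m)^-1 <= y n + 2 * (a n)^-1.
  move=> Nn; elim: m => [|m IHm]; first by rewrite leqn0 => /eqP ->.
  rewrite leq_eqVlt => /orP[/eqP->//|nm].
  have /andP[_ ym] := y_step m; have := IHm nm.
  have /= := HN m (leq_trans Nn nm); lra.
have y_ub n : (N <= n)%N -> ubound (range y) (y n + 2 * (a n)^-1).
  move=> Nn _ [m _ <-]; have [mn|/ltnW nm] := leqP m n.
    by rewrite (le_trans (y_mono _ _ mn))// lerDl mulr_ge0// invr_ge0 ltW.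
  rewrite (le_trans _ (y_le m n Nn nm))// lerDl mulr_ge0// invr_ge0 ltW//.
have y_has_ub : has_ubound (range y) by exists (y N + 2 * (a N)^-1); exact: y_ub.
pose x := sup (range y); exists x.
have y_le_x n : y n <= x by apply: ub_le_sup => //; exists n.
have x_le n : (N <= n)%N -> x <= y n + 2 * (a n)^-1.
  by move=> Nn; apply: ge_sup (y_ub n Nn); exists (y 0), 0%N.
have bound0 : (2 * (a n / a n.+1)) @[n --> \oo] --> (0 : R).
  by rewrite -[X in _ --> X](mulr0 2); apply: cvgM => //; exact: cvg_cst.
apply: squeeze_cvgr (cvg_cst 0) bound0; near=> n; rewrite distZ_ge0 /=.
rewrite (le_trans (distZ_le _ (Num.ceil (a n * y n - f n))))//.
rewrite -approx_hit// -/y.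
have -> : a n * x - f n - (a n * y n.+1 - f n) = a n * (x - y n.+1) by ring.
rewrite ger0_norm ?mulr_ge0 ?subr_ge0 ?(ltW (a0 n))//.
rewrite mulrCA ler_pM2l// lerBlDl x_le//.
by near: n; exists N => // n /= /leqW.
Unshelve. all: by end_near. Qed.

Lemma ideal_null_perturb {R : realType} (I : set (set nat)) (u v : nat -> R) :
  omega_ideal I -> (u n - v n) @[n --> \oo] --> (0 : R) ->
  ideal_null I u -> ideal_null I v.
Proof.
move=> [Isub IU Ifin _] uv Iu e e0; have e20 : 0 < e / 2 by rewrite divr_gt0.
have fin : finite_set [set n | e / 2 <= `|u n - v n|].
  apply/finite_set_near; have /cvgrPdist_lt/(_ _ e20) := uv.
  by apply: filterS => n; rewrite sub0r normrN /= ltNge => /negP.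
apply: Isub (IU _ _ (Iu _ e20) (Ifin _ fin)) => n /= evn.
have [?|uev] := leP (e / 2) (u n); [by left|right => /=].
by rewrite distrC (le_trans _ (ler_norm _))//; lra.
Qed.

Lemma ideal_star_null_perturb {R : realType} (I : set (set nat))
    (u v : nat -> R) :
  (u n - v n) @[n --> \oo] --> (0 : R) ->
  ideal_star_null I u -> ideal_star_null I v.
Proof.
move=> uv [S IS uS]; exists S => //.
have -> : v = (fun n => u n - (u n - v n)) by apply/funext => n; ring.
by rewrite -[X in _ --> X](subr0 0); apply: cvgB uS (cvg_within_filter _ uv).
Qed.

Theorem theorem2p3 (R : realType) (I : set (set nat)) (hI : omega_ideal I) :
  [<-> P_ideal I;
       forall a : nat -> int, Hset R a I = Hset_star R a I;
       exists a : nat -> nat,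
         [/\ forall n, a n <> 0%N,
             ((a n)%:R / (a n.+1)%:R : R) @[n --> \oo] --> (0 : R)
           & Hset R (fun n => (a n)%:Z) I = Hset_star R (fun n => (a n)%:Z) I]].
Proof.
tfae.
- move=> IP a; apply/seteqP; split=> t /=.
    by apply: (P_ideal_null_star I _ IP) => n; exact: distZ_ge0.
  by apply: (ideal_star_null_null I _ hI) => n; exact: distZ_ge0.
- move=> HH; exists factorial; split.
  + by move=> n; apply/eqP; rewrite -lt0n fact_gt0.
  + have -> : (fun n => (n`!)%:R / (n.+1`!)%:R : R) = harmonic.
      by apply/funext => n; rewrite factS natrM invfM mulrCA divff ?mulr1//.
    exact: cvg_harmonic.
  + exact: HH.
- move=> [a [a_neq0 a_lac HH]]; apply: (@P_ideal_of_null_star R) => // f f01 If.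
  have a_gt0 n : 0 < (a n)%:R :> R by rewrite ltr0n lt0n; exact/eqP.
  have [x xf] := lacunary_approx (fun n => (a n)%:R) f a_gt0 a_lac.
  pose w n := distZ ((a n)%:R * x).
  have wf : (w n - f n) @[n --> \oo] --> (0 : R).
    apply/norm_cvg0P; apply: squeeze_cvgr (cvg_cst 0) xf; near=> n.
    by rewrite normr_ge0 /= -{1}(distZ_half _ _ (f01 n)) distZ_dist.
  apply: (ideal_star_null_perturb I w) => //.
  have wE : (fun n => tnorm (((\pi_(torus R) x)%qT : torus R) *~ (a n)%:Z - 0)) = w.
    by apply/funext => n; rewrite subr0 -pi_torusMz tnorm_pi -mulrzl.
  have : Hset R (fun n => (a n)%:Z) I (\pi_(torus R) x)%qT.
    have : ideal_null I w.
      apply: (ideal_null_perturb I f) => //.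
      by under eq_fun do rewrite -opprB; rewrite -oppr0; exact: cvgN.
    by rewrite -wE.
  by rewrite HH /Hset_star /= /ideal_star_cvg wE.
Unshelve. all: by end_near. Qed.
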